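(* There exists a universal constant $C\le 570$ with the following property. Let $(p_i)_{i\ge1}$ be a sequence of probabilities in $(0,1)$, let $n\ge 1$, and let $X_n=\sum_{i=1}^n Y_i$, where $Y_1,\ldots,Y_n$ are independent Bernoulli random variables with $\mathbb{P}[Y_i=1]=p_i=1-\mathbb{P}[Y_i=0]$. Denote by $\mu_n$ the distribution of $X_n$ and set $$\lambda_n=\sum_{i=1}^n p_i,\qquad (\sigma_n)^2=\sum_{i=1}^n (p_i)^2 .$$ Suppose that $\lambda_n>16\,e\,(\sigma_n)^2$. Then for every $r\ge 1$, if $\nu_n^{(r)}$ is the approximation scheme of order $r$ of $\mu_n$ (with Poisson parameter $\lambda_n$), one has $$d_{\mathrm{TV}}(\mu_n,\nu_n^{(r)})\le C\,(\eta_n)^{r+1},\qquad\text{with }\ \eta_n=\frac{4\sqrt{e}\,\sigma_n}{\sqrt{\lambda_n}}<1 .$$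
   Context: $\mathbb{N}=\{0,1,2,\ldots\}$, $e=\exp(1)$. For signed measures $\mu,\nu$ on $\mathbb{N}$, $d_{\mathrm{TV}}(\mu,\nu)=\frac12\sum_{k\in\mathbb{N}}|\mu(k)-\nu(k)|$. Approximation scheme: write $$\mathbb{E}[e^{i\xi X_n}]\,e^{-\lambda_n(e^{i\xi}-1)}=\prod_{i=1}^n\big(1+p_i(e^{i\xi}-1)\big)e^{-p_i(e^{i\xi}-1)}=1+\sum_{s=2}^\infty b_{s,n}(e^{i\xi}-1)^s ,$$ where the $b_{s,n}$ are the coefficients of the power series expansion of the entire function $z\mapsto\prod_{i=1}^n(1+p_iz)e^{-p_iz}$. The approximation scheme of order $r$ of $\mu_n$ is the signed measure $\nu_n^{(r)}$ on $\mathbb{N}$ with Fourier transform $$\sum_{k\in\mathbb{N}}\nu_n^{(r)}(k)e^{ik\xi}=e^{\lambda_n(e^{i\xi}-1)}\Big(1+\sum_{s=2}^r b_{s,n}(e^{i\xi}-1)^s\Big).$$ *)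

(* Defs.v *)
From HB Require Import structures.
From mathcomp Require Import all_boot all_order all_algebra.
From mathcomp Require Import complex.
From mathcomp Require Import all_classical all_reals all_analysis.

Set Implicit Arguments.
Unset Strict Implicit.
Unset Printing Implicit Defensive.

Import Order.TTheory GRing.Theory Num.Theory.
Import numFieldNormedType.Exports.

Local Open Scope classical_set_scope.
Local Open Scope ring_scope.
Local Open Scope complex_scope.

(* The topology and norm on R[i] are those that every numFieldType receives; the
   library only declares them for abstract structures. *)
#[non_forgetful_inheritance]
HB.instance Definition _ (R : rcfType) := NormedModule.copy R[i] R[i]^o.

(* Mutual independence: the product rule holds for every subfamily J. *)
Definition independent_RVs (d d' : measure_display) (T : measurableType d)
    (T' : measurableType d') (R : realType) (P : probability T R)
    (I : finType) (Y : I -> {RV P >-> T'}) : Prop :=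
  forall (J : {set I}) (A : I -> set T'),
    (forall i, measurable (A i)) ->
    P (\bigcap_(i in [set` J]) (Y i @^-1` A i)) =
    (\prod_(i in J) P (Y i @^-1` A i))%E.

(* Extended-real valued, so that no summability side condition is needed. *)
Definition dTV (R : realType) (mu nu : set nat -> \bar R) : \bar R :=
  (2^-1%:E * \sum_(k <oo) `|mu [set k] - nu [set k]|)%E.

Section approximation_scheme.
Variable R : realType.

Definition cexp (z : R[i]) : R[i] :=
  let: x +i* y := z in (expR x * cos y) +i* (expR x * sin y).

(* b is the sequence of coefficients of an everywhere convergent power series
   with sum f, i.e. of the expansion at 0 of the entire function f. *)
Definition entire_expansion (b : nat -> R[i]) (f : R[i] -> R[i]) : Prop :=
  forall z : R[i], series (fun s => b s * z ^+ s) @ \oo --> f z.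

(* g is the Fourier transform of the signed measure nu on nat; a charge is
   finite valued, so that fine loses no information. *)
Definition has_Fourier_transform (nu : {charge set nat -> \bar R})
    (g : R -> R[i]) : Prop :=
  forall xi : R,
    series (fun k => (fine (nu [set k]))%:C * cexp (0 +i* (k%:R * xi))) @ \oo
      --> g xi.

(* Sequences are indexed from 0: p i is the (i+1)-st probability. *)
Definition lambda_ (p : nat -> R) (n : nat) : R := \sum_(i < n) p i.

Definition sigma_ (p : nat -> R) (n : nat) : R :=
  Num.sqrt (\sum_(i < n) p i ^+ 2).

Definition eta_ (p : nat -> R) (n : nat) : R :=
  4 * Num.sqrt (expR 1) * sigma_ p n / Num.sqrt (lambda_ p n).

Definition residue_function (p : nat -> R) (n : nat) (z : R[i]) : R[i] :=
  \prod_(i < n) ((1 + (p i)%:C * z) * cexp (- ((p i)%:C * z))).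

(* nu is the approximation scheme of order r: both the coefficients b and nu
   itself are uniquely determined by these conditions. *)
Definition approximation_scheme (p : nat -> R) (n r : nat)
    (nu : {charge set nat -> \bar R}) : Prop :=
  exists b : nat -> R[i],
    entire_expansion b (residue_function p n) /\
    has_Fourier_transform nu (fun xi =>
      let w := cexp (0 +i* xi) - 1 in
      cexp ((lambda_ p n)%:C * w) *
      (1 + \sum_(2 <= s < r.+1) b s * w ^+ s)).

End approximation_scheme.

(* Main.v *)
Require Import Defs.
From HB Require Import structures.
From mathcomp Require Import all_boot all_order all_algebra.
From mathcomp Require Import complex.
From mathcomp Require Import all_classical all_reals all_analysis.
From mathcomp Require Import ring lra.

Set Implicit Arguments.
Unset Strict Implicit.
Unset Printing Implicit Defensive.

Import Order.TTheory GRing.Theory Num.Theory.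
Import numFieldNormedType.Exports.
Import Normc.

Local Open Scope classical_set_scope.
Local Open Scope ring_scope.
Local Open Scope complex_scope.

(** Put w = exp(i xi) - 1, lambda = sum of the p i, sigma^2 = sum of the (p i)^2, and
   let f be the entire function with coefficients b s. The law of X has Fourier
   transform exp(lambda w) f(w), and nu has exp(lambda w) times the Taylor polynomial
   of f of degree r at w. Since exp(lambda w) w^s is the Fourier transform of the s-th
   difference D^s of the Poisson distribution of parameter lambda, the error is the
   sum over s > r of b s times D^s, and its l1 norm is at most the sum over s > r of
   |b s| times the l1 norm of D^s. Two estimates are multiplied.

   The coefficients: |(1 + z) exp(-z)| <= exp(|z|^2 / 2), so |f| is at most
   exp(sigma^2 rho^2 / 2) on the circle of radius rho, and Cauchy's estimate with
   rho = sqrt s / sigma gives |b s| <= (sqrt e sigma / sqrt s)^s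
   (normc_residue_coef).

   The differences: D^s is the s-fold convolution of the first difference of the
   Poisson distribution of parameter t = lambda / s, whose l1 norm is E|N - t| / t, at
   most 1 / sqrt t by the variance of N. Hence the l1 norm of D^s is at most
   (sqrt s / sqrt lambda)^s (norm1_iter_diff_poisson).

   The powers of s cancel: the product is (sqrt e sigma / sqrt lambda)^s, that is
   (eta / 4)^s. The geometric series is dominated by its first term, and the constant
   can be taken to be 1.

   Complex analysis is reduced to polynomials: averaging over the K-th roots of unity
   bounds each coefficient of a polynomial of degree less than K by its maximum on the
   unit circle, and this passes to absolutely summable series (coef_le_fourier). The
   same lemma yields Cauchy's estimate, and recovers the masses of nu from its Fourier
   transform. *)

(** * Complex numbers and coefficients of Fourier series *)

Section complex_plane.
Variable R : realType.
Implicit Types (z w : R[i]) (x t : R).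

Lemma norm_normc z : `|z| = (normc z)%:C.
Proof. by case: z. Qed.

Lemma normc_ge0 z : 0 <= normc z.
Proof. by case: z => a b; exact: sqrtr_ge0. Qed.

Lemma normc_real x : normc x%:C = `|x|.
Proof. by rewrite /= expr0n addr0 sqrtr_sqr. Qed.

Lemma normc_prod (I : Type) (s : seq I) (F : I -> R[i]) :
  normc (\prod_(i <- s) F i) = \prod_(i <- s) normc (F i).
Proof.
by elim/big_rec2 : _ => [|i x z _ <-]; rewrite ?normc1// normcM.
Qed.

Lemma normcX z n : normc (z ^+ n) = normc z ^+ n.
Proof.
by elim: n => [|n IH]; rewrite ?expr0 ?normc1// !exprS normcM IH.
Qed.

Lemma le_normc_sum (I : Type) (s : seq I) (P : pred I) (F : I -> R[i]) :
  normc (\sum_(i <- s | P i) F i) <= \sum_(i <- s | P i) normc (F i).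
Proof.
elim/big_ind2 : _ => //; first by rewrite normc0.
by move=> z x w y zx wy; rewrite (le_trans (le_normcD _ _))// lerD.
Qed.

Lemma le_normcB z w : normc (z - w) <= normc z + normc w.
Proof. by rewrite (le_trans (le_normcD _ _))// normcN. Qed.

Lemma cvg_normcP (u : nat -> R[i]) l : u @ \oo --> l <->
  forall e : R, 0 < e -> exists N, forall n, (N <= n)%N -> normc (l - u n) < e.
Proof.
split=> [/cvgrPdist_lt ul e e0|ul].
  have [N _ NP] : \forall n \near \oo, `|l - u n| < e%:C.
    by apply: ul; rewrite ltcR.
  by exists N => n Nn; move: (NP n Nn); rewrite /= norm_normc ltcR.
apply/cvgrPdist_lt => e e0; have eE : e = (complex.Re e)%:C.
  by rewrite RRe_real// gtr0_real.
move: e0; rewrite eE ltcR => /ul[N NP].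
by exists N => // n Nn /=; rewrite norm_normc ltcR NP.
Qed.

Lemma cvg_complex (u v : nat -> R) (x y : R) :
  u @ \oo --> x -> v @ \oo --> y ->
  (fun n => u n +i* v n) @ \oo --> x +i* y.
Proof.
move=> /cvgrPdist_lt ux /cvgrPdist_lt vy; apply/cvg_normcP => e e0.
have e2 : 0 < e / 2 by rewrite divr_gt0.
have [N _ NP] := ux _ e2; have [N' _ N'P] := vy _ e2.
exists (maxn N N') => n; rewrite geq_max => /andP[Nn N'n].
have -> : (x +i* y) - (u n +i* v n) = (x - u n)%:C + (0 +i* (y - v n)).
  by simpc.
apply: (le_lt_trans (le_normcD _ _)); rewrite [ltRHS]splitr ltrD//.
  by rewrite normc_real; exact: NP.
by rewrite /= expr0n add0r sqrtr_sqr; exact: N'P.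
Qed.

Lemma cvgD_scaled (u v : nat -> R[i]) (a b c : R[i]) :
  u @ \oo --> a -> v @ \oo --> b -> (fun n => u n + c * v n) @ \oo --> a + c * b.
Proof. by move=> ua vb; apply: cvgD; [exact: ua|apply: cvgMr; exact: vb]. Qed.

Definition cis t : R[i] := cexp (0 +i* t).

Lemma cisE t : cis t = cos t +i* sin t.
Proof. by rewrite /cis /cexp expR0 !mul1r. Qed.

Lemma cexpD z w : cexp (z + w) = cexp z * cexp w.
Proof.
case: z w => [a b] [c d] /=; rewrite /cexp expRD cosD sinD; simpc.
by congr (_ +i* _); ring.
Qed.

Lemma cexp0 : cexp 0 = 1 :> R[i].
Proof. by rewrite /cexp /= expR0 cos0 sin0 mulr1 mulr0. Qed.

Lemma cexp_sum (I : Type) (s : seq I) (F : I -> R[i]) :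
  cexp (\sum_(i <- s) F i) = \prod_(i <- s) cexp (F i).
Proof. exact: (big_morph (@cexp R) cexpD cexp0). Qed.

Lemma cexpN z : cexp z * cexp (- z) = 1.
Proof. by rewrite -cexpD subrr cexp0. Qed.

Lemma cexp_real x : cexp x%:C = (expR x)%:C.
Proof. by rewrite /cexp /= cos0 sin0 mulr1 mulr0. Qed.

Lemma normc_cexp z : normc (cexp z) = expR (complex.Re z).
Proof.
case: z => a b /=; rewrite !exprMn -mulrDr cos2Dsin2 mulr1 sqrtr_sqr.
by rewrite ger0_norm// expR_ge0.
Qed.

Lemma normc_cis t : normc (cis t) = 1.
Proof. by rewrite normc_cexp expR0. Qed.

Lemma cisD t x : cis (t + x) = cis t * cis x.
Proof. by rewrite -cexpD; simpc. Qed.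

Lemma cisMn t n : cis (n%:R * t) = cis t ^+ n.
Proof.
elim: n => [|n IH]; first by rewrite mul0r expr0 /cis cexp0.
by rewrite -natr1 mulrDl mul1r cisD IH exprSr.
Qed.

Lemma Re_real_mul x z : complex.Re (x%:C * z) = x * complex.Re z.
Proof. by case: z => a b /=; rewrite mul0r subr0. Qed.

(** From cos (2 a) = 1 - 2 (sin a)^2, as the sine does not vanish between 0 and pi. *)
Lemma root_of_unity_neq1 (K d : nat) : (0 < d < K)%N ->
  cis (2 * pi / K%:R) ^+ d != 1.
Proof.
move=> /andP[d0 dK]; have K0 : (0 < K%:R :> R).
  by rewrite ltr0n (leq_trans _ dK).
rewrite -cisMn cisE eq_complex /= negb_and; apply/orP; left.
have -> : d%:R * (2 * pi / K%:R) = (d%:R * pi / K%:R) *+ 2 :> R by ring.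
rewrite cos_mulr2n cos2sin2.
have : 0 < sin (d%:R * pi / K%:R : R).
  apply: sin_gt0_pi; have K1 : (0 < K)%N by rewrite (leq_trans _ dK).
  rewrite divr_gt0 ?mulr_gt0 ?pi_gt0 ?ltr0n//=.
  by rewrite ltr_pdivrMr// mulrC ltr_pM2l ?pi_gt0// ltr_nat.
move=> s0; rewrite mulr2n; apply/negP => /eqP h.
have := mulr_gt0 s0 s0; rewrite -expr2; lra.
Qed.

Lemma root_of_unity_exp (K : nat) : (0 < K)%N -> cis (2 * pi / K%:R) ^+ K = 1.
Proof.
move=> K0; rewrite -cisMn mulrCA mulfV ?mulr1 ?pnatr_eq0 -?lt0n//.
by rewrite cisE mulr_natl cos2pi sin2pi.
Qed.

Lemma sum_root_of_unity (K d : nat) : (0 < d < K)%N ->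
  \sum_(j < K) (cis (2 * pi / K%:R) ^+ d) ^+ j = 0.
Proof.
move=> dK; set w := cis _ ^+ d.
have w1 : w - 1 != 0 by rewrite subr_eq0 root_of_unity_neq1.
have K0 : (0 < K)%N by case: K dK {w w1} => //; rewrite ltn0 andbF.
apply: (mulfI w1); rewrite mulr0 -subrX1 /w -exprM mulnC exprM.
by rewrite root_of_unity_exp// expr1n subrr.
Qed.

(** A discrete Cauchy estimate: averaging z^(-m) times the polynomial over the
   K-th roots of unity extracts the coefficient of index m exactly. *)
Lemma coef_le_circle (a : nat -> R[i]) (K m : nat) (M : R) : (m < K)%N ->
  (forall t, normc (\sum_(k < K) a k * cis t ^+ k) <= M) -> normc (a m) <= M.
Proof.
move=> mK aM; have K0 : (0 < K)%N by rewrite (leq_trans _ mK).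
pose w := cis (2 * pi / K%:R); pose v := cis (- (2 * pi / K%:R)).
have wv : v * w = 1 by rewrite -cisD addNr /cis cexp0.
have avg : \sum_(j < K) (v ^+ m) ^+ j * (\sum_(k < K) a k * (w ^+ j) ^+ k)
    = K%:R * a m.
  under eq_bigr do rewrite mulr_sumr.
  rewrite exchange_big /= (bigD1 (Ordinal mK))//= [X in _ + X]big1 ?addr0.
    rewrite (eq_bigr (fun=> a m)) ?sumr_const ?card_ord ?mulr_natl//.
    move=> j _; rewrite mulrCA -!exprM [(j * m)%N]mulnC -exprMn wv expr1n.
    by rewrite mulr1.
  move=> k km.
  rewrite (eq_bigr (fun j : 'I_K => a k * (v ^+ m * w ^+ k) ^+ j)); last first.
    by move=> j _; rewrite mulrCA [w ^+ j ^+ k]exprAC -exprMn.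
  rewrite -mulr_sumr; have [mk|km'] := ltnP m k.
    rewrite -(subnKC (ltnW mk)) exprD mulrA -exprMn wv expr1n mul1r.
    rewrite sum_root_of_unity ?mulr0// subn_gt0 mk.
    by rewrite (leq_ltn_trans (leq_subr _ _)).
  have km'' : (k < m)%N by rewrite ltn_neqAle km' andbT; move: km; rewrite -val_eqE.
  rewrite -(subnKC km') exprD -mulrA [v ^+ (m - k) * _]mulrC mulrA -exprMn wv.
  rewrite expr1n mul1r.
  have d : (0 < m - k < K)%N.
    by rewrite subn_gt0 km'' (leq_ltn_trans (leq_subr _ _)).
  (* as w ^+ K = 1, the negative power of w is a positive one *)
  have vE : v ^+ (m - k) = w ^+ (K - (m - k)).
    have := root_of_unity_exp K0.
    rewrite -/w -{1}(subnKC (ltnW (proj2 (andP d)))) exprD => wE.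
    by rewrite -[LHS]mulr1 -wE mulrA -exprMn wv expr1n mul1r.
  rewrite vE sum_root_of_unity ?mulr0//.
  by move: d => /andP[d0 dK]; rewrite subn_gt0 dK ltn_subrL d0 K0.
have KR : (0 < K%:R :> R) by rewrite ltr0n.
rewrite -(ler_pM2l KR) -[X in X * _](ger0_norm (ltW KR)) -normc_real -normcM.
have -> : K%:R%:C = K%:R :> R[i] by rewrite rmorph_nat.
rewrite -avg (le_trans (le_normc_sum _ _ _))//.
apply: (@le_trans _ _ (\sum_(j < K) M)); last first.
  by rewrite sumr_const card_ord mulr_natl.
apply: ler_sum => j _; rewrite normcM !normcX normc_cis !expr1n mul1r.
by rewrite -cisMn.
Qed.

Definition bounded_sums (a : nat -> R) := exists B, forall n, \sum_(k < n) a k <= B.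

Lemma bounded_sums_tail (a : nat -> R) e : (forall k, 0 <= a k) ->
  bounded_sums a -> 0 < e ->
  exists N, forall n, \sum_(N <= k < n) a k <= e.
Proof.
move=> a0 [B aB] e0.
have cs : cvgn (series a).
  apply: nondecreasing_is_cvgn; first exact/nondecreasing_series.
  by exists B => _ [n _ <-]; rewrite /series /= big_mkord.
have /cvgrPdist_le/(_ e e0)[N _ NP] := cs.
exists N => n; have [nN|Nn] := ltnP n N.
  by rewrite big_geq ?(ltnW nN)// (ltW e0).
rewrite -sub_series_geq//.
have := NP N (leqnn _); rewrite /= ler_distl => /andP[_ h].
have : series a n <= limn (series a).
  by apply: nondecreasing_cvgn_le => //; exact/nondecreasing_series.
lra.
Qed.

(** An absolutely summable Fourier series is uniformly close to its partial sums,
   so the estimate on coefficients passes to the series. With M = 0 this says that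
   a summable sequence is determined by its Fourier transform; for the sequence
   b s * rho ^ s it is the Cauchy estimate on the circle of radius rho. *)
Lemma coef_le_fourier (a : nat -> R[i]) (g : R -> R[i]) (M : R) (m : nat) :
  bounded_sums (fun k => normc (a k)) ->
  (forall t, series (fun k => a k * cis t ^+ k) @ \oo --> g t) ->
  (forall t, normc (g t) <= M) -> normc (a m) <= M.
Proof.
move=> aB ag gM; apply/ler_addgt0Pr => e e0.
have e2 : 0 < e / 2 by rewrite divr_gt0.
have [N NP] := bounded_sums_tail (fun k => normc_ge0 (a k)) aB e2.
have mK : (m < maxn N m.+1)%N by rewrite leq_max leqnn orbT.
apply: (coef_le_circle mK) => t; set K := maxn N m.+1.
have /cvg_normcP/(_ _ e2)[N' N'P] := ag t.
pose n := maxn N' K; have Kn : (K <= n)%N by rewrite leq_maxr.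
have -> : \sum_(k < K) a k * cis t ^+ k =
    g t - ((g t - series (fun k => a k * cis t ^+ k) n)
           + \sum_(K <= k < n) a k * cis t ^+ k).
  rewrite /series /= (@big_cat_nat _ _ _ K 0 n)//= big_mkord.
  by ring.
apply: (le_trans (le_normcB _ _)); rewrite lerD//.
apply: (le_trans (le_normcD _ _)); rewrite [leRHS](splitr e) lerD//.
  by rewrite ltW// N'P// leq_maxl.
apply: (le_trans (le_normc_sum _ _ _)).
rewrite (eq_bigr (fun k => normc (a k))); last first.
  by move=> k _; rewrite normcM normcX normc_cis expr1n mulr1.
apply: le_trans (NP n).
rewrite [leRHS](@big_cat_nat _ _ _ K)//= ?leq_maxl// lerDr sumr_ge0// => k _.
exact: normc_ge0.
Qed.

End complex_plane.

(** * Convolutions and the exponential series *)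

Section convolution.
Variable F : comNzRingType.
Implicit Types f g : nat -> F.

Definition conv f g (n : nat) : F := \sum_(i < n.+1) f i * g (n - i)%N.

(** The convolution of f with the difference of the unit masses at 1 and at 0. *)
Definition diff f (n : nat) : F := (if n is m.+1 then f m else 0) - f n.

Lemma convC f g : conv f g = conv g f.
Proof.
apply/funext => n; rewrite /conv (reindex_inj rev_ord_inj)/=.
by apply: eq_bigr => i _; rewrite mulrC subSS subKn// -ltnS.
Qed.

Lemma diff_convl f g : diff (conv f g) = conv (diff f) g.
Proof.
apply/funext => n; rewrite {2}/conv /diff.
under eq_bigr do rewrite mulrBl.
rewrite sumrB; congr (_ - _); case: n => [|n].
  by rewrite big_ord_recl big_ord0 mul0r addr0.
rewrite big_ord_recl mul0r add0r /conv.
by apply: eq_bigr => i _; rewrite /= /bump subSS.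
Qed.

Lemma diff_convr f g : diff (conv f g) = conv f (diff g).
Proof. by rewrite convC diff_convl convC. Qed.

Lemma iter_diff_convl s f g : iter s diff (conv f g) = conv (iter s diff f) g.
Proof. by elim: s => //= s ->; rewrite diff_convl. Qed.

Lemma sum_conv f g N :
  \sum_(n < N) conv f g n = \sum_(i < N) f i * \sum_(j < N - i) g j.
Proof.
elim: N => [|N IH]; first by rewrite !big_ord0.
rewrite big_ord_recr/= IH /conv [in RHS]big_ord_recr/=.
rewrite [in X in _ + X = _]big_ord_recr/=.
rewrite addrA -big_split/=; congr (_ + _); last first.
  by rewrite subnn subSnn big_ord_recl big_ord0 addr0.
apply: eq_bigr => i _; rewrite -mulrDr subSn ?(ltnW (ltn_ord i))//.
by rewrite big_ord_recr.
Qed.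

End convolution.

Section exponential_series.

Definition exp_term (F : unitRingType) (x : F) (n : nat) : F := x ^+ n / n`!%:R.

Lemma exp_termD (F : numFieldType) (x y : F) :
  exp_term (x + y) = conv (exp_term x) (exp_term y).
Proof.
apply/funext => n; rewrite /exp_term /conv exprDn mulr_suml.
rewrite [RHS](reindex_inj rev_ord_inj)/=.
apply: eq_bigr => i _; have ni : (i <= n)%N by rewrite -ltnS.
rewrite subSS subKn// -(bin_fact ni) !natrM -mulr_natr.
have C0 : 'C(n, i)%:R != 0 :> F by rewrite pnatr_eq0 -lt0n bin_gt0.
have i0 : i`!%:R != 0 :> F by rewrite pnatr_eq0 -lt0n fact_gt0.
have ni0 : (n - i)`!%:R != 0 :> F by rewrite pnatr_eq0 -lt0n fact_gt0.
by field; rewrite C0 i0 ni0.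
Qed.

Variable R : realType.
Implicit Types (z w : R[i]) (x y t : R).

Lemma cvg_exp_term x : series (exp_term x) @ \oo --> expR x.
Proof. exact: is_cvg_series_exp_coeff. Qed.

Lemma sum_exp_term_le x n : 0 <= x -> \sum_(k < n) exp_term x k <= expR x.
Proof.
move=> x0; rewrite -(big_mkord xpredT (exp_term x)) -(cvg_lim _ (@cvg_exp_term x))//.
apply: nondecreasing_cvgn_le; last exact: (cvgP _ (@cvg_exp_term x)).
by apply: nondecreasing_series => k _ _; rewrite divr_ge0 ?exprn_ge0.
Qed.

Lemma normc_exp_term z n : normc (exp_term z n) = exp_term (normc z) n.
Proof.
rewrite normcM normcX normcV; congr (_ / _).
by rewrite -(rmorph_nat (real_complex R)) normc_real ger0_norm.
Qed.

(** The Cauchy product of two exponential series: the terms which the product of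
   the partial sums has in excess are dominated by the same terms for the moduli,
   and those vanish in the limit because expR is a morphism. *)
Lemma cvg_exp_termD z w (a b : R[i]) :
  series (exp_term z) @ \oo --> a -> series (exp_term w) @ \oo --> b ->
  series (exp_term (z + w)) @ \oo --> a * b.
Proof.
move=> za wb.
have /cvg_normcP prod : series (exp_term z) n * series (exp_term w) n @[n --> \oo]
    --> a * b by exact: (@cvgM R[i] nat \oo _ _ _ a b za wb).
have : series (exp_term (normc z)) n * series (exp_term (normc w)) n
    - series (exp_term (normc z + normc w)) n @[n --> \oo] --> 0.
  rewrite -(subrr (expR (normc z + normc w))) {1}expRD.
  by apply: cvgB; [apply: cvgM|]; exact: (@cvg_exp_term).
move=> /cvgrPdist_lt excess; apply/cvg_normcP => e e0.
have e2 : 0 < e / 2 by rewrite divr_gt0.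
have [N NP] := prod _ e2; have [N' _ N'P] := excess _ e2.
exists (maxn N N') => n; rewrite geq_max => /andP[Nn N'n].
pose Sz := series (exp_term z) n; pose Sw := series (exp_term w) n.
have -> : a * b - series (exp_term (z + w)) n =
    (a * b - Sz * Sw) + (Sz * Sw - series (exp_term (z + w)) n) by ring.
apply: (le_lt_trans (le_normcD _ _)); rewrite [ltRHS]splitr.
apply: ltr_leD; first exact: NP.
have sumD (F : numFieldType) (x y : F) :
    series (exp_term x) n * series (exp_term y) n - series (exp_term (x + y)) n
    = \sum_(i < n) exp_term x i * \sum_(n - i <= j < n) exp_term y j.
  rewrite /series/= !big_mkord exp_termD sum_conv mulr_suml -sumrB.
  apply: eq_bigr => i _; rewrite -mulrBr; congr (_ * _).
  rewrite -!(big_mkord xpredT) (@big_cat_nat _ _ _ (n - i) 0 n) ?leq_subr//=.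
  by rewrite addrAC subrr add0r.
apply: ltW; apply: le_lt_trans (N'P n N'n).
rewrite sub0r normrN sumD /Sz /Sw sumD; apply: le_trans (ler_norm _).
apply: (le_trans (le_normc_sum _ _ _)); apply: ler_sum => i _.
rewrite normcM normc_exp_term ler_wpM2l ?divr_ge0 ?exprn_ge0 ?normc_ge0//.
apply: (le_trans (le_normc_sum _ _ _)); apply: ler_sum => j _.
by rewrite normc_exp_term.
Qed.

Lemma exp_term_imaginary y n :
  exp_term (0 +i* y) n = cos_coeff y n +i* sin_coeff y n.
Proof.
have -> : 0 +i* y = y%:C * 'i by simpc.
have iX m : 'i ^+ m.*2 = ((-1) ^+ m)%:C :> R[i].
  by rewrite -mul2n exprM sqr_i rmorphXn/= rmorphN1.
rewrite /exp_term exprMn -(rmorphXn (real_complex R)) -(rmorph_nat (real_complex R)).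
rewrite -fmorphV/= mulrAC -rmorphM/= /cos_coeff /sin_coeff.
have -> : 'i ^+ n =
    (if odd n then ((-1) ^+ n./2)%:C * 'i else ((-1) ^+ n./2)%:C) :> R[i].
  rewrite -{1}(odd_double_half n); case: (odd n); last by rewrite add0n iX.
  by rewrite add1n exprSr iX.
case: (boolP (odd n)) => odd_n /=.
  have -> : n.-1./2 = n./2.
    by rewrite -{1}(odd_double_half n) odd_n add1n /= doubleK.
  by rewrite odd_n /= -exprnP; simpc; congr (_ +i* _); ring.
by rewrite odd_n (negPf odd_n) /= -exprnP; simpc; congr (_ +i* _); ring.
Qed.

Lemma cvg_exp_term_cexp z : series (exp_term z) @ \oo --> cexp z.
Proof.
have real_part x : series (exp_term x%:C) @ \oo --> cexp x%:C.
  rewrite cexp_real (_ : series _ = fun n => series (exp_term x) n +i* 0).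
    by apply: cvg_complex (@cvg_exp_term x) _; exact: cvg_cst.
  apply/funext => n.
  rewrite -[RHS]/((series (exp_term x) n)%:C) /series/= rmorph_sum.
  apply: eq_bigr => k _.
  by rewrite /exp_term rmorphM/= rmorphXn/= fmorphV/= rmorph_nat.
have imaginary_part y : series (exp_term (0 +i* y)) @ \oo --> cis y.
  have cosy : series (cos_coeff y) @ \oo --> cos y.
    by rewrite unlock; exact: is_cvg_series_cos_coeff.
  have siny : series (sin_coeff y) @ \oo --> sin y.
    by rewrite unlock; exact: is_cvg_series_sin_coeff.
  rewrite cisE (_ : series _ =
      fun n => series (cos_coeff y) n +i* series (sin_coeff y) n).
    exact: cvg_complex cosy siny.
  apply/funext => n; rewrite /series/=; elim: n => [|n IH].
    by rewrite !big_geq.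
  by rewrite !big_nat_recr//= IH exp_term_imaginary; simpc.
have -> : z = (complex.Re z)%:C + (0 +i* complex.Im z).
  by case: z => a b; simpc.
by rewrite cexpD; exact: cvg_exp_termD.
Qed.

End exponential_series.

(** * Differences of the Poisson distribution *)

Section poisson.
Variable R : realType.
Implicit Types (x y t : R).

Definition poisson t (k : nat) : R := expR (- t) * exp_term t k.

Lemma poissonD x y : poisson (x + y) = conv (poisson x) (poisson y).
Proof.
apply/funext => n; rewrite /poisson exp_termD /conv opprD expRD mulr_sumr.
by apply: eq_bigr => i _; ring.
Qed.

Lemma poisson_ge0 t k : 0 <= t -> 0 <= poisson t k.
Proof. by move=> t0; rewrite mulr_ge0 ?expR_ge0// divr_ge0 ?exprn_ge0. Qed.

Lemma sum_poisson_le1 t n : 0 <= t -> \sum_(k < n) poisson t k <= 1.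
Proof.
move=> t0; rewrite -mulr_sumr expRN mulrC ler_pdivrMr ?expR_gt0// mul1r.
exact: sum_exp_term_le.
Qed.

Lemma poissonS t k : t * poisson t k = k.+1%:R * poisson t k.+1.
Proof.
rewrite /poisson /exp_term factS natrM exprS.
have k0 : k`!%:R != 0 :> R by rewrite pnatr_eq0 -lt0n fact_gt0.
have : k.+1%:R != 0 :> R by rewrite pnatr_eq0.
by move: k.+1%:R => u u0; field; rewrite k0 u0.
Qed.

(** The boundary term is nonpositive for n >= t, so that no partial sum of the
   variance exceeds t. *)
Lemma sum_poisson_sqr t n :
  \sum_(k < n.+1) (k%:R - t) ^+ 2 * poisson t k =
  t * (\sum_(k < n) poisson t k) + t * (t - n%:R) * poisson t n.
Proof.
elim: n => [|n IH].
  by rewrite big_ord_recl !big_ord0 /=; ring.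
rewrite big_ord_recr/= IH [in RHS]big_ord_recr/= -natr1.
have := poissonS t n; rewrite -natr1 => h.
apply/eqP; rewrite -subr_eq0; apply/eqP; set s := \sum_(i < n) _.
transitivity ((n%:R + 1 - t) * ((n%:R + 1) * poisson t n.+1 - t * poisson t n)).
  by ring.
by rewrite -h subrr mulr0.
Qed.

Lemma sum_poisson_sqr_le t n : 0 <= t ->
  \sum_(k < n) (k%:R - t) ^+ 2 * poisson t k <= t.
Proof.
move=> t0; pose m := maxn n (Num.truncn t).+1.
apply: (@le_trans _ _ (\sum_(k < m.+1) (k%:R - t) ^+ 2 * poisson t k)).
  rewrite -!(big_mkord xpredT (fun k => (k%:R - t) ^+ 2 * poisson t k)).
  rewrite [leRHS](@big_cat_nat _ _ _ n)//= ?(leq_trans (leq_maxl _ _) (leqnSn _))//.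
  by rewrite lerDl sumr_ge0// => k _; rewrite mulr_ge0 ?sqr_ge0 ?poisson_ge0.
rewrite sum_poisson_sqr -[leRHS]addr0 lerD//.
  by rewrite -[leRHS]mulr1 ler_wpM2l// sum_poisson_le1.
rewrite mulr_le0_ge0 ?poisson_ge0// mulr_ge0_le0// subr_le0.
apply: (@le_trans _ _ (Num.truncn t).+1%:R); first by rewrite ltW// truncnS_gt.
by rewrite ler_nat leq_maxr.
Qed.

(** One has poisson t (k-1) - poisson t k = poisson t k * (k/t - 1), so that the
   l1 norm of the difference is E|N - t| / t, at most sqrt (Var N) / t. The proof
   uses the inequality 2 |x| <= c x^2 + 1/c with c = sqrt t. *)
Lemma norm1_diff_poisson t n : 0 < t ->
  \sum_(k < n) `|diff (poisson t) k| <= (Num.sqrt t)^-1.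
Proof.
move=> t0; set c := Num.sqrt t; have c0 : 0 < c by rewrite sqrtr_gt0.
have cc : c ^+ 2 = t by rewrite sqr_sqrtr// ltW.
have key k : `|diff (poisson t) k| <=
    ((c ^+ 3)^-1 * ((k%:R - t) ^+ 2 * poisson t k) + c^-1 * poisson t k) / 2.
  have -> : diff (poisson t) k = (k%:R - t) / t * poisson t k.
    case: k => [|k]; rewrite /diff; first by field; rewrite gt_eqF.
    apply: (mulfI (lt0r_neq0 t0)); rewrite mulrBr poissonS.
    by field; rewrite gt_eqF.
  rewrite normrM (ger0_norm (poisson_ge0 _ (ltW t0))).
  have -> : (c ^+ 3)^-1 * ((k%:R - t) ^+ 2 * poisson t k) + c^-1 * poisson t k
      = ((c ^+ 3)^-1 * (k%:R - t) ^+ 2 + c^-1) * poisson t k by ring.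
  rewrite mulrAC ler_wpM2r ?poisson_ge0 ?(ltW t0)//.
  rewrite normrM normfV (gtr0_norm t0) -(real_normK (num_real (k%:R - t))) -cc.
  set u := `|_|; rewrite -subr_ge0.
  have -> : ((c ^+ 3)^-1 * u ^+ 2 + c^-1) / 2 - u / c ^+ 2
      = (c ^+ 3)^-1 * (u - c) ^+ 2 / 2 by field; rewrite gt_eqF.
  rewrite divr_ge0// mulr_ge0 ?sqr_ge0//.
  by rewrite invr_ge0 exprn_ge0// ltW.
apply: le_trans; first by apply: ler_sum => k _; exact: key.
rewrite -mulr_suml big_split/= -2!mulr_sumr ler_pdivrMr//.
apply: (@le_trans _ _ ((c ^+ 3)^-1 * t + c^-1 * 1)).
  rewrite lerD// ler_wpM2l ?invr_ge0 ?exprn_ge0 ?(ltW c0)//.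
    exact: sum_poisson_sqr_le (ltW t0).
  exact: sum_poisson_le1 (ltW t0).
rewrite -cc le_eqVlt; apply/orP; left; apply/eqP; field.
by rewrite gt_eqF.
Qed.

Lemma norm1_conv (f g : nat -> R) A B :
  (forall n, \sum_(k < n) `|f k| <= A) -> (forall n, \sum_(k < n) `|g k| <= B) ->
  forall n, \sum_(k < n) `|conv f g k| <= A * B.
Proof.
move=> fA gB n; have B0 : 0 <= B by rewrite (le_trans _ (gB 0%N))// big_ord0.
apply: (@le_trans _ _ (\sum_(k < n) conv (fun i => `|f i|) (fun i => `|g i|) k)).
  apply: ler_sum => k _; apply: (le_trans (ler_norm_sum _ _ _)).
  by apply: ler_sum => i _; rewrite normrM.
rewrite sum_conv; apply: (@le_trans _ _ (\sum_(i < n) `|f i| * B)).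
  by apply: ler_sum => i _; rewrite ler_wpM2l//; exact: gB.
by rewrite -mulr_suml ler_wpM2r.
Qed.

(** The s-th difference of the Poisson distribution of parameter s t is the s-fold
   convolution of the first difference of the one of parameter t. *)
Lemma norm1_iter_diff_poisson t s n : 0 < t ->
  \sum_(k < n) `|iter s (@diff R) (poisson (s%:R * t)) k| <= (Num.sqrt t)^-1 ^+ s.
Proof.
move=> t0; elim: s n => [|s IH] n.
  rewrite mul0r expr0 /=; apply: le_trans (sum_poisson_le1 n (lexx 0)).
  by apply: ler_sum => k _; rewrite ger0_norm// poisson_ge0.
have -> : s.+1%:R * t = s%:R * t + t by rewrite -natr1; ring.
rewrite poissonD /= iter_diff_convl diff_convr exprSr.
by apply: norm1_conv => // m; exact: norm1_diff_poisson.
Qed.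

Lemma cvg_poisson t (z : R[i]) :
  series (fun k => (poisson t k)%:C * z ^+ k) @ \oo --> cexp (t%:C * (z - 1)).
Proof.
have -> : cexp (t%:C * (z - 1)) = (expR (- t))%:C * cexp (t%:C * z).
  by rewrite -cexp_real -cexpD rmorphN/=; congr cexp; ring.
rewrite (_ : series _ = fun n => (expR (- t))%:C * series (exp_term (t%:C * z)) n).
  by apply: cvgMr; exact: cvg_exp_term_cexp.
apply/funext => n; rewrite /series/= mulr_sumr; apply: eq_bigr => k _.
rewrite /poisson /exp_term !rmorphM/= rmorphXn/= fmorphV/= rmorph_nat exprMn.
by ring.
Qed.

Lemma cvg_diff (f : nat -> R) (z l : R[i]) :
  series (fun k => (f k)%:C * z ^+ k) @ \oo --> l ->
  series (fun k => (diff f k)%:C * z ^+ k) @ \oo --> l * (z - 1).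
Proof.
move=> fl; rewrite mulrBr mulr1 mulrC -(cvg_shiftS _).
rewrite (_ : (fun n => _) = fun n => z * series (fun k => (f k)%:C * z ^+ k) n
   - series (fun k => (f k)%:C * z ^+ k) n.+1); last first.
  apply/funext => n; rewrite /series/= /diff !big_mkord.
  rewrite big_ord_recl [in RHS]big_ord_recl/=.
  rewrite mulr_sumr expr0 mulr1 sub0r rmorphN/= opprD addrCA; congr (_ + _).
    by rewrite mulr1.
  by rewrite -sumrB; apply: eq_bigr => k _; rewrite rmorphB/= exprS; ring.
by apply: cvgB; [apply: cvgMr|rewrite cvg_shiftS].
Qed.

Lemma cvg_iter_diff_poisson t s (z : R[i]) :
  series (fun k => (iter s (@diff R) (poisson t) k)%:C * z ^+ k) @ \oo -->
  cexp (t%:C * (z - 1)) * (z - 1) ^+ s.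
Proof.
elim: s => [|s IH]; first by rewrite expr0 mulr1; exact: cvg_poisson.
by rewrite exprSr mulrA; exact: cvg_diff.
Qed.

End poisson.

(** * Power series expansions of entire functions *)

Section entire_expansions.
Variable R : realType.
Implicit Types (b : nat -> R[i]) (f : R[i] -> R[i]) (z : R[i]) (rho : R).

Lemma sum_geometric_le (q : R) n : 0 <= q < 1 -> \sum_(k < n) q ^+ k <= (1 - q)^-1.
Proof.
move=> /andP[q0 q1]; rewrite -[leRHS]mul1r ler_pdivlMr ?subr_gt0// mulrC.
rewrite -opprB mulNr -subrX1 opprB.
by rewrite lerBlDr lerDl exprn_ge0.
Qed.

Lemma cvg_series_bounded (u : nat -> R[i]) (l : R[i]) : series u @ \oo --> l ->
  exists B, forall k, normc (u k) <= B.
Proof.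
move=> /cvg_normcP/(_ 1 ltr01)[N NP]; exists (2 + \sum_(k < N) normc (u k)) => k.
have sum0 : 0 <= \sum_(k < N) normc (u k).
  by rewrite sumr_ge0// => i _; exact: normc_ge0.
have [kN|Nk] := ltnP k N.
  rewrite (bigD1 (Ordinal kN))//= addrCA lerDl addr_ge0//.
  by rewrite sumr_ge0// => i _; exact: normc_ge0.
apply: (@le_trans _ _ 2); last by rewrite lerDl.
have -> : u k = (l - series u k) - (l - series u k.+1).
  by rewrite /series/= big_nat_recr//=; ring.
by rewrite (le_trans (le_normcB _ _))// lerD// ltW// NP// (leq_trans Nk).
Qed.

(** The terms of the series are bounded at 2 rho, which leaves a geometric factor
   (1/2)^s at rho. *)
Lemma expansion_summable b f rho : entire_expansion b f -> 0 <= rho ->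
  bounded_sums (fun s => normc (b s) * rho ^+ s).
Proof.
move=> bf rho0; have [B BP] := cvg_series_bounded (bf (2 * rho)%:C).
exists (B * (1 - 2^-1)^-1) => n.
have B0 : 0 <= B by rewrite (le_trans (normc_ge0 _) (BP 0%N)).
apply: (@le_trans _ _ (\sum_(k < n) B * 2^-1 ^+ k)); last first.
  by rewrite -mulr_sumr ler_wpM2l// sum_geometric_le//; lra.
apply: ler_sum => k _; rewrite exprVn ler_pdivlMr ?exprn_gt0//.
apply: le_trans (BP k); rewrite normcM normcX normc_real ger0_norm ?mulr_ge0//.
by rewrite exprMn mulrA mulrAC.
Qed.

Lemma cauchy_estimate b f rho M s : entire_expansion b f -> 0 <= rho ->
  (forall z, normc z = rho -> normc (f z) <= M) -> normc (b s) * rho ^+ s <= M.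
Proof.
move=> bf rho0 fM.
have nrho : normc rho%:C = rho by rewrite normc_real ger0_norm.
rewrite -nrho -normcX -normcM.
apply: (@coef_le_fourier _ (fun k => b k * rho%:C ^+ k) (fun t => f (rho%:C * cis t))).
- have [B BP] := expansion_summable bf rho0; exists B => n; apply: le_trans (BP n).
  by apply: ler_sum => k _; rewrite normcM normcX nrho.
- move=> t; have := bf (rho%:C * cis t).
  by under eq_fun do rewrite exprMn mulrA.
- by move=> t; apply: fM; rewrite normcM normc_cis mulr1.
Qed.

Lemma expansion_tail b f rho e : entire_expansion b f -> 0 <= rho -> 0 < e ->
  exists N, forall S z, (N <= S)%N -> normc z <= rho ->
    normc (f z - \sum_(s < S) b s * z ^+ s) <= e.
Proof.
move=> bf rho0 e0; have e2 : 0 < e / 2 by rewrite divr_gt0.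
have pos s : 0 <= normc (b s) * rho ^+ s by rewrite mulr_ge0 ?normc_ge0 ?exprn_ge0.
have [N NP] := bounded_sums_tail pos (expansion_summable bf rho0) e2.
exists N => S z NS zrho; have /cvg_normcP/(_ _ e2)[N' N'P] := bf z.
pose n := maxn N' S; have Sn : (S <= n)%N by rewrite leq_maxr.
have -> : f z - \sum_(s < S) b s * z ^+ s =
    (f z - series (fun s => b s * z ^+ s) n) + \sum_(S <= s < n) b s * z ^+ s.
  rewrite /series/= (@big_cat_nat _ _ _ S 0 n)//= big_mkord.
  by ring.
apply: (le_trans (le_normcD _ _)); rewrite [leRHS]splitr lerD//.
  by rewrite ltW// N'P// leq_maxl.
apply: (le_trans (le_normc_sum _ _ _)); apply: le_trans (NP n).
rewrite [leRHS](@big_cat_nat _ _ _ S)//= -[leLHS]add0r lerD ?sumr_ge0//.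
apply: ler_sum => s _; rewrite normcM normcX ler_wpM2l ?normc_ge0//.
by rewrite lerXn2r// nnegrE ?normc_ge0.
Qed.

Lemma expansion_coef0 b f : entire_expansion b f -> b 0%N = f 0.
Proof.
move=> bf; apply/eqP; rewrite eq_sym -subr_eq0; apply/eqP/eq0_normc/eqP.
rewrite eq_le normc_ge0 andbT; apply/ler_addgt0Pr => e e0; rewrite add0r.
have [N NP] := expansion_tail bf (lexx 0) e0.
have := NP N.+1 0 (leqnSn N); rewrite normc0 => /(_ (lexx 0)).
rewrite big_ord_recl expr0 mulr1 big1 ?addr0// => i _.
by rewrite expr0n mulr0.
Qed.

(** The coefficient of index 1 is a derivative at 0, for which one real direction
   is enough. *)
Lemma expansion_coef1_eq0 b f K : entire_expansion b f ->
  (forall x : R, 0 < x <= 1 -> normc (f x%:C - f 0) <= K * x ^+ 2) -> b 1%N = 0.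
Proof.
move=> bf fK; apply/eq0_normc/eqP; rewrite eq_le normc_ge0 andbT.
have K0 : 0 <= K.
  have := fK 1; rewrite ltr01 lexx expr1n mulr1 => /(_ isT).
  exact: le_trans (normc_ge0 _).
have [B BP] := expansion_summable bf ler01.
have B0 : 0 <= B by rewrite (le_trans _ (BP 0%N))// big_ord0.
apply/ler_addgt0Pr => e e0; rewrite add0r.
(* the proof shows that normc (b 1) * x <= (K + B) * x ^+ 2 for 0 < x <= 1 *)
pose x := Num.min 1 (e / (K + B + 1)).
have KB : 0 < K + B + 1 by rewrite ltr_wpDl// addr_ge0.
have x0 : 0 < x by rewrite lt_min ltr01 divr_gt0.
have x1 : x <= 1 by rewrite ge_min lexx.
apply: (@le_trans _ _ ((K + B) * x)); last first.
  apply: (@le_trans _ _ ((K + B) * (e / (K + B + 1)))).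
    by rewrite ler_wpM2l ?addr_ge0// ge_min lexx orbT.
  by rewrite mulrCA ger_pMr// ler_pdivrMr// mul1r lerDl.
rewrite -(ler_pM2r x0) -mulrA -expr2; apply/ler_addgt0Pr => d d0.
have [N NP] := expansion_tail bf (ltW x0) d0.
have nx : normc x%:C = x by rewrite normc_real gtr0_norm.
have := NP N.+2 x%:C (leq_trans (leqnSn _) (leqnSn _)); rewrite nx => /(_ (lexx x)).
rewrite 2!big_ord_recl expr0 mulr1 (expansion_coef0 bf)/= /bump/= expr1.
set T := \sum_(i < N) _ => fT; rewrite -[X in _ * X <= _]nx -normcM.
have -> : b (1 + 0)%N * x%:C =
    (f x%:C - f 0) - T - (f x%:C - (f 0 + (b (1 + 0)%N * x%:C + T))).
  by ring.
apply: (le_trans (le_normcB _ _)); apply: lerD => //.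
apply: (le_trans (le_normcB _ _)); rewrite mulrDl lerD//.
  by apply: fK; rewrite x0 x1.
apply: (le_trans (le_normc_sum _ _ _)).
apply: (@le_trans _ _ (\sum_(i < N) normc (b i.+2) * x ^+ 2)).
  apply: ler_sum => i _; rewrite normcM normcX nx ler_wpM2l ?normc_ge0//.
  by rewrite ler_wiXn2l// ltW.
rewrite -mulr_suml ler_wpM2r ?sqr_ge0//; apply: le_trans (BP N.+2).
rewrite 2!big_ord_recl/= addrA -[leLHS]add0r.
rewrite lerD ?addr_ge0 ?mulr_ge0 ?normc_ge0 ?expr1n//.
by apply: ler_sum => i _; rewrite expr1n mulr1.
Qed.

End entire_expansions.

(** * The residue function *)

Section residue_function.
Variable R : realType.
Implicit Types (p : nat -> R) (z : R[i]) (u x : R).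

(** |1 + z|^2 = 1 + (2 Re z + |z|^2) is at most the exponential of the parenthesis. *)
Lemma normc_residue_factor z :
  normc ((1 + z) * cexp (- z)) <= expR (normc z ^+ 2 / 2).
Proof.
rewrite normcM normc_cexp -(@ler_pXn2r _ 2)// ?nnegrE ?expR_ge0 ?mulr_ge0 ?normc_ge0//.
rewrite exprMn -!expRM_natl.
case: z => x y /=; rewrite !sqr_sqrtr ?addr_ge0 ?sqr_ge0//.
rewrite mulrN expRN ler_pdivrMr ?expR_gt0// -expRD.
apply: le_trans (expR_ge1Dx _).
by rewrite le_eqVlt; apply/orP; left; apply/eqP; field.
Qed.

Lemma sqr_sigma p n : sigma_ p n ^+ 2 = \sum_(i < n) p i ^+ 2.
Proof. by rewrite sqr_sqrtr// sumr_ge0// => i _; exact: sqr_ge0. Qed.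

Lemma normc_residue p n z :
  normc (residue_function p n z) <= expR (sigma_ p n ^+ 2 * normc z ^+ 2 / 2).
Proof.
rewrite normc_prod sqr_sigma !mulr_suml expR_sum; apply: ler_prod => i _.
rewrite normc_ge0/=; apply: (le_trans (normc_residue_factor _)).
by rewrite normcM normc_real exprMn real_normK ?num_real.
Qed.

Lemma residue_function0 p n : residue_function p n 0 = 1.
Proof.
by rewrite /residue_function big1// => i _; rewrite mulr0 addr0 oppr0 cexp0 mulr1.
Qed.

Lemma onem_prod_le (I : Type) (s : seq I) (g : I -> R) : (forall i, 0 <= g i <= 1) ->
  0 <= 1 - \prod_(i <- s) g i <= \sum_(i <- s) (1 - g i).
Proof.
move=> g01; elim: s => [|i s /andP[IH0 IH]]; first by rewrite !big_nil subrr lexx.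
rewrite !big_cons; have /andP[g0 g1] := g01 i; move: IH0 IH.
set P := \prod_(_ <- _) _; set S := \sum_(_ <- _) _ => IH0 IH.
have -> : 1 - g i * P = (1 - g i) + g i * (1 - P) by ring.
rewrite addr_ge0 ?subr_ge0 ?mulr_ge0//=.
by rewrite lerD2l (le_trans _ IH)// ler_piMl.
Qed.

Lemma residue_factor_real u : 0 <= u <= 1 ->
  0 <= (1 + u) * expR (- u) <= 1 /\ 1 - (1 + u) * expR (- u) <= u ^+ 2.
Proof.
move=> /andP[u0 u1]; split.
  rewrite mulr_ge0 ?expR_ge0 ?addr_ge0//= expRN ler_pdivrMr ?expR_gt0// mul1r.
  exact: expR_ge1Dx.
rewrite lerBlDr -lerBlDl; have -> : 1 - u ^+ 2 = (1 + u) * (1 - u) by ring.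
by rewrite ler_wpM2l ?addr_ge0// expR_ge1Dx.
Qed.

Lemma residue_function_real p n x : (forall i, 0 < p i < 1) -> 0 < x <= 1 ->
  normc (residue_function p n x%:C - residue_function p n 0) <=
  sigma_ p n ^+ 2 * x ^+ 2.
Proof.
move=> p01 /andP[x0 x1]; rewrite residue_function0 sqr_sigma mulr_suml.
pose g i := (1 + p i * x) * expR (- (p i * x)).
have px i : 0 <= p i * x <= 1.
  have /andP[p0 p1] := p01 i; rewrite mulr_ge0 ?(ltW p0) ?(ltW x0)//=.
  by rewrite mulr_ile1// ltW.
have -> : residue_function p n x%:C = (\prod_(i < n) g i)%:C.
  rewrite rmorph_prod; apply: eq_bigr => i _.
  rewrite -(rmorphM (real_complex R)) -(rmorphN (real_complex R)) cexp_real.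
  by rewrite [RHS](rmorphM (real_complex R)) (rmorphD (real_complex R)) rmorph1.
have -> : (\prod_(i < n) g i)%:C - 1 = (\prod_(i < n) g i - 1)%:C.
  by rewrite rmorphB rmorph1.
rewrite normc_real distrC.
have /andP[h0 h1] : 0 <= 1 - \prod_(i < n) g i <= \sum_(i < n) (1 - g i).
  by apply: onem_prod_le => i; have [] := residue_factor_real (px i).
rewrite ger0_norm//; apply: (le_trans h1); apply: ler_sum => i _.
by rewrite -exprMn; have [] := residue_factor_real (px i).
Qed.

End residue_function.

(** * Charges on nat and the law of a sum of Bernoulli variables *)

Section probability.
Variable R : realType.

Lemma charge_restriction_bounded (nu : {charge set nat -> \bar R}) (A : set nat) :
  exists B, forall n, `|\sum_(k < n) fine (nu (A `&` [set nat_of_ord k]))| <= B.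
Proof.
pose F k := A `&` [set k].
have mF k : measurable (F k) by [].
have tF : trivIset setT F by move=> i j _ _ [k [[_ /= ->] [_ /= ->]]].
have FA : \bigcup_k F k = A.
  by apply/seteqP; split=> [k [j _ []]//|k Ak]; exists k.
have nuA : (fun n => \sum_(0 <= k < n) nu (F k))%E @ \oo --> nu A.
  by rewrite -FA; apply: charge_semi_sigma_additive.
have finF k : nu (F k) = (fine (nu (F k)))%:E by rewrite fineK// fin_num_measure.
have finA : nu A = (fine (nu A))%:E by rewrite fineK// fin_num_measure.
move: nuA; rewrite finA.
under eq_fun do under eq_bigr do rewrite finF.
under eq_fun do rewrite sumEFin.
move=> /fine_cvgP[_ /= h].
have /cvg_seq_bounded/pinfty_ex_gt0[B _ BP] := cvgP _ h.
by exists B => n; have := BP n I; rewrite /= big_mkord.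
Qed.

(** The points where nu is nonnegative and their complement have finite charge. *)
Lemma charge_summable (nu : {charge set nat -> \bar R}) :
  bounded_sums (fun k => `|fine (nu [set k])|).
Proof.
pose A := [set k | 0 <= fine (nu [set k])].
have [B1 B1P] := charge_restriction_bounded nu A.
have [B2 B2P] := charge_restriction_bounded nu (~` A).
exists (B1 + B2) => n.
have -> : \sum_(k < n) `|fine (nu [set nat_of_ord k])| =
    \sum_(k < n) fine (nu (A `&` [set nat_of_ord k]))
    - \sum_(k < n) fine (nu (~` A `&` [set nat_of_ord k])).
  rewrite -sumrB; apply: eq_bigr => k _.
  have inside (B : set nat) : B k -> B `&` [set nat_of_ord k] = [set nat_of_ord k].
    by move=> Bk; apply/setIidr => _ ->.
  have outside (B : set nat) : ~ B k -> B `&` [set nat_of_ord k] = set0.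
    by move=> Bk; apply/seteqP; split=> // j [Bj /= jk]; apply: Bk; rewrite -jk.
  have [Ak|Ak] := pselect (A k).
    rewrite inside// outside; last by move=> /(_ Ak).
    by rewrite charge0 subr0 ger0_norm.
  rewrite outside// inside// charge0 sub0r ltr0_norm// ltNge.
  exact/negP.
by rewrite (le_trans (ler_norm _))// (le_trans (ler_normB _ _))// lerD.
Qed.

Lemma measure_finite_union d (T : measurableType d) (P : probability T R)
    (I : finType) (Q : pred I) (F : I -> set T) :
  (forall i, measurable (F i)) -> trivIset setT F ->
  P (\bigcup_(i in [set i | Q i]) F i) = (\sum_(i | Q i) P (F i))%E.
Proof.
move=> mF tF; have fQ : finite_set [set i | Q i] by exact: finite_finset.
rewrite measure_fin_bigcup//; last exact: sub_trivIset tF.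
rewrite (_ : [set i | Q i] = [set` [seq i <- index_enum I | Q i]]).
  by rewrite -fsbig_seq ?filter_uniq ?index_enum_uniq// big_filter.
by apply/seteqP; split=> i /=; rewrite mem_filter mem_index_enum andbT.
Qed.

Definition bernoulli_weight (p : nat -> R) (n : nat) (J : {set 'I_n}) : R :=
  \prod_(i < n) (if i \in J then p i else 1 - p i).

Definition bernoulli_sum_pmf (p : nat -> R) (n k : nat) : R :=
  \sum_(J : {set 'I_n} | #|J| == k) bernoulli_weight p J.

(** Let E J be the event that Y i is 1 for i in J and 0 for the other i. These events
   are disjoint, and their probabilities add up to the product of the
   p i + (1 - p i), which is 1: up to a null event, X is the cardinal of J on E J for
   one of the J. *)
Lemma bernoulli_sum_law d (T : measurableType d) (P : probability T R)
    (p : nat -> R) (n : nat) (Y : 'I_n -> {RV P >-> nat}) (X : {RV P >-> nat}) k :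
  (forall i : 'I_n, P (Y i @^-1` [set 1%N]) = (p i)%:E) ->
  (forall i : 'I_n, P (Y i @^-1` [set 0%N]) = (1 - p i)%:E) ->
  independent_RVs Y -> (forall t : T, X t = (\sum_(i < n) Y i t)%N) ->
  P (X @^-1` [set k]) = (bernoulli_sum_pmf p n k)%:E.
Proof.
move=> Y1 Y0 Yind XE.
pose A (J : {set 'I_n}) (i : 'I_n) : set nat := [set nat_of_bool (i \in J)].
pose E (J : {set 'I_n}) : set T :=
  \bigcap_(i in [set` [set: 'I_n]%SET]) (Y i @^-1` A J i).
have EP J t : E J t -> forall i, Y i t = (i \in J).
  by move=> EJt i; apply: EJt; rewrite /= inE.
have mY i B : measurable (Y i @^-1` B).
  by rewrite -[X in measurable X]setTI; exact: measurable_funPT.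
have mE J : measurable (E J) by apply: fin_bigcap_measurable => // i _; exact: mY.
have tE : trivIset setT E.
  move=> J J' _ _ [t [/EP EJ /EP EJ']]; apply/setP => i.
  by have := EJ i; rewrite EJ'; do 2 case: (_ \in _).
have PE J : P (E J) = (bernoulli_weight p J)%:E.
  rewrite Yind// -prodEFin big_mkcond/=; apply: eq_bigr => i _.
  by rewrite inE /A; case: (i \in J).
pose U := \bigcup_(J in [set J | true]) E J.
have mU : measurable U by apply: fin_bigcup_measurable.
have PU : P U = 1%E.
  rewrite measure_finite_union//; under eq_bigr do rewrite PE.
  rewrite sumEFin; congr _%:E; transitivity (\prod_(i < n) (p i + (1 - p i))).
    by rewrite bigA_distr; apply: eq_bigl => J; rewrite inE.
  by rewrite big1// => i _; rewrite addrC subrK.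
have mX : measurable (X @^-1` [set k]).
  by rewrite -[X in measurable X]setTI; exact: measurable_funPT.
have cardE J t : E J t -> X t = #|J|.
  move=> /EP EJ; rewrite XE -sum1_card [RHS]big_mkcond/=.
  by apply: eq_bigr => i _; rewrite EJ; case: (_ \in _).
have PXU : P (X @^-1` [set k] `\` U) = 0%E.
  apply/eqP; rewrite eq_le measure_ge0 andbT.
  apply: (@le_trans _ _ (P (~` U))); last by rewrite probability_setC// PU subee.
  apply: le_measure; rewrite ?inE; [exact: measurableD|exact: measurableC|].
  by move=> t [].
have -> : P (X @^-1` [set k]) = P (X @^-1` [set k] `&` U).
  rewrite -[RHS]add0e -PXU; exact: measureDI.
rewrite (_ : _ `&` U = \bigcup_(J in [set J : {set 'I_n} | #|J| == k]) E J).
  by rewrite measure_finite_union//; under eq_bigr do rewrite PE; rewrite sumEFin.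
apply/seteqP; split=> [t [/= Xt [J _ EJt]]|t [J /= /eqP Jk EJt]].
  by exists J => //=; rewrite -Xt (cardE J).
by split; [rewrite /= (cardE J)|exists J].
Qed.

Lemma bernoulli_sum_pmf_eq0 (p : nat -> R) n k : (n < k)%N ->
  bernoulli_sum_pmf p n k = 0.
Proof.
move=> nk; apply: big_pred0 => J; apply/negbTE; rewrite neq_ltn; apply/orP; left.
by rewrite (leq_ltn_trans _ nk)// -[leqRHS]card_ord max_card.
Qed.

Lemma sum_bernoulli_sum_pmf (p : nat -> R) n N (z : R[i]) : (n < N)%N ->
  \sum_(k < N) (bernoulli_sum_pmf p n k)%:C * z ^+ k =
  \prod_(i < n) (1 + (p i)%:C * (z - 1)).
Proof.
move=> nN.
transitivity (\sum_(J : {set 'I_n}) (bernoulli_weight p J)%:C * z ^+ #|J|).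
  have cardN (J : {set 'I_n}) : (#|J| < N)%N.
    by rewrite (leq_ltn_trans _ nN)// -[leqRHS]card_ord max_card.
  rewrite (partition_big (fun J => Ordinal (cardN J)) xpredT)//=.
  apply: eq_bigr => k _; rewrite rmorph_sum mulr_suml.
  by apply: eq_big => [J|J /eqP <-]; rewrite -?val_eqE.
transitivity (\prod_(i < n) ((p i)%:C * z + (1 - p i)%:C)); last first.
  by apply: eq_bigr => i _; rewrite rmorphB rmorph1; ring.
rewrite bigA_distr; apply: eq_bigr => J _.
rewrite -prodr_const /bernoulli_weight rmorph_prod [X in _ * X]big_mkcond -big_split.
by apply: eq_bigr => i _ /=; case: (i \in J); rewrite ?mulr1.
Qed.

Lemma cvg_bernoulli_sum_pmf (p : nat -> R) n t :
  series (fun k => (bernoulli_sum_pmf p n k)%:C * cis t ^+ k) @ \oo -->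
  cexp ((lambda_ p n)%:C * (cis t - 1)) * residue_function p n (cis t - 1).
Proof.
have -> : cexp ((lambda_ p n)%:C * (cis t - 1)) * residue_function p n (cis t - 1)
    = \prod_(i < n) (1 + (p i)%:C * (cis t - 1)).
  rewrite /lambda_ rmorph_sum mulr_suml cexp_sum -big_split.
  by apply: eq_bigr => i _; rewrite [LHS]mulrCA cexpN mulr1.
apply/cvg_normcP => e e0; exists n.+1 => N nN.
by rewrite /series/= big_mkord sum_bernoulli_sum_pmf// subrr normc0.
Qed.

Lemma bernoulli_sum_pmf_summable (p : nat -> R) n :
  bounded_sums (fun k => `|bernoulli_sum_pmf p n k|).
Proof.
exists (\sum_(k < n.+1) `|bernoulli_sum_pmf p n k|) => N.
rewrite -!(big_mkord xpredT (fun k => `|bernoulli_sum_pmf p n k|)).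
have [Nn|nN] := leqP N n.+1.
  by rewrite [leRHS](@big_cat_nat _ _ _ N)//= lerDl sumr_ge0.
rewrite (@big_cat_nat _ _ _ n.+1 0 N) ?(ltnW nN)//= [X in _ + X <= _]big1_seq ?addr0//.
move=> k; rewrite mem_index_iota => /andP[_ /andP[nk _]].
by rewrite bernoulli_sum_pmf_eq0// normr0.
Qed.

End probability.

(** * The error of the approximation scheme *)

Section poisson_approximation.
Variables (R : realType) (p : nat -> R) (n : nat).
Hypothesis p01 : forall i, 0 < p i < 1.
Hypothesis n_gt0 : (0 < n)%N.

Lemma lambda_gt0 : 0 < lambda_ p n.
Proof.
rewrite /lambda_; case: n n_gt0 => // m _; rewrite big_ord_recl ltr_pwDl//.
  by have /andP[] := p01 0.
by rewrite sumr_ge0// => i _; have /andP[/ltW] := p01 (lift ord0 i).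
Qed.

Lemma sigma_gt0 : 0 < sigma_ p n.
Proof.
rewrite sqrtr_gt0; case: n n_gt0 => // m _; rewrite big_ord_recl ltr_pwDl//.
  by have /andP[p0 _] := p01 0; rewrite exprn_gt0.
by rewrite sumr_ge0// => i _; exact: sqr_ge0.
Qed.

Variable b : nat -> R[i].
Hypothesis b_expansion : entire_expansion b (residue_function p n).

Lemma residue_coef0 : b 0%N = 1.
Proof. by rewrite (expansion_coef0 b_expansion) residue_function0. Qed.

Lemma residue_coef1 : b 1%N = 0.
Proof.
apply: (expansion_coef1_eq0 b_expansion (K := sigma_ p n ^+ 2)) => x.
exact: residue_function_real.
Qed.

(** The Cauchy estimate on the circle of radius sqrt s / sigma, which minimizes
   exp (sigma^2 rho^2 / 2) / rho^s. *)
Lemma normc_residue_coef s : (0 < s)%N ->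
  normc (b s) <= (Num.sqrt (expR 1) * sigma_ p n / Num.sqrt s%:R) ^+ s.
Proof.
move=> s0; have sg := sigma_gt0; set sigma := sigma_ p n in sg *.
have sR : 0 < s%:R :> R by rewrite ltr0n.
set c := Num.sqrt s%:R; have c0 : 0 < c by rewrite sqrtr_gt0.
have rho0 : 0 < c / sigma by rewrite divr_gt0.
have -> : Num.sqrt (expR 1) * sigma / c = Num.sqrt (expR 1) / (c / sigma) :> R.
  by field; rewrite !gt_eqF.
rewrite exprMn exprVn ler_pdivlMr ?exprn_gt0//.
apply: (cauchy_estimate s b_expansion (ltW rho0)) => z zrho.
apply: (le_trans (normc_residue p n z)); rewrite zrho -/sigma.
have -> : sigma ^+ 2 * (c / sigma) ^+ 2 / 2 = s%:R / 2.
  have -> : s%:R = c ^+ 2 :> R by rewrite sqr_sqrtr// ltW.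
  by field; rewrite gt_eqF.
have -> : Num.sqrt (expR 1) = expR (1 / 2) :> R.
  have -> : expR 1 = expR (1 / 2) ^+ 2 :> R by rewrite -expRM_natl; congr expR; field.
  by rewrite sqrtr_sqr ger0_norm// expR_ge0.
by rewrite -expRM_natl mul1r.
Qed.

Lemma fourier_bound t : normc (cexp ((lambda_ p n)%:C * (cis t - 1))) <= 1.
Proof.
rewrite normc_cexp Re_real_mul -[leRHS]expR0 ler_expR mulr_ge0_le0 ?(ltW lambda_gt0)//.
by rewrite cisE /= subr_le0 cos_le1.
Qed.

Let D s := iter s (@diff R) (poisson (lambda_ p n)).

Lemma norm1_iter_diff_poisson_lambda s N : (0 < s)%N ->
  \sum_(k < N) `|D s k| <= (Num.sqrt s%:R / Num.sqrt (lambda_ p n)) ^+ s.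
Proof.
move=> s0; have l0 := lambda_gt0; have sR : 0 < s%:R :> R by rewrite ltr0n.
have t0 : 0 < lambda_ p n / s%:R by rewrite divr_gt0.
have := norm1_iter_diff_poisson s N t0.
rewrite mulrC divfK ?gt_eqF// => h; apply: (le_trans h).
by rewrite sqrtrM ?(ltW l0)// sqrtrV ?(ltW sR)// invfM invrK mulrC.
Qed.

Let w t : R[i] := cis t - 1.

Lemma cvg_correction r S t :
  series (fun k => (\sum_(r <= s < S) b s * (D s k)%:C) * cis t ^+ k) @ \oo -->
  cexp ((lambda_ p n)%:C * w t) * \sum_(r <= s < S) b s * w t ^+ s.
Proof.
have empty S' : (S' <= r)%N ->
    series (fun k => (\sum_(r <= s < S') b s * (D s k)%:C) * cis t ^+ k) @ \oo -->
    cexp ((lambda_ p n)%:C * w t) * \sum_(r <= s < S') b s * w t ^+ s.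
  move=> S'r; rewrite (big_geq S'r) mulr0 (_ : series _ = fun=> 0).
    exact: cvg_cst.
  by apply/funext => j; rewrite /series/= big1// => k _; rewrite (big_geq S'r) mul0r.
elim: S => [|S IH]; first exact: empty.
have [Sr|rS] := ltnP S r; first exact: empty.
have -> : cexp ((lambda_ p n)%:C * w t) * (\sum_(r <= s < S.+1) b s * w t ^+ s) =
    cexp ((lambda_ p n)%:C * w t) * (\sum_(r <= s < S) b s * w t ^+ s)
    + b S * (cexp ((lambda_ p n)%:C * w t) * w t ^+ S).
  by rewrite big_nat_recr//= mulrDr; congr (_ + _); rewrite mulrCA.
rewrite (_ : series _ = fun m =>
     series (fun k => (\sum_(r <= s < S) b s * (D s k)%:C) * cis t ^+ k) m
   + b S * series (fun k => (D S k)%:C * cis t ^+ k) m).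
  by apply: cvgD_scaled; [exact: IH|exact: cvg_iter_diff_poisson].
apply/funext => m; rewrite /series/= mulr_sumr -big_split/=; apply: eq_bigr => k _.
by rewrite big_nat_recr//= mulrDl mulrA.
Qed.

Variables (m v : nat -> R) (r : nat).
Hypothesis r_gt0 : (0 < r)%N.
Hypothesis m_summable : bounded_sums (fun k => `|m k|).
Hypothesis v_summable : bounded_sums (fun k => `|v k|).
Hypothesis m_fourier : forall t,
  series (fun k => (m k)%:C * cis t ^+ k) @ \oo -->
  cexp ((lambda_ p n)%:C * w t) * residue_function p n (w t).
Hypothesis v_fourier : forall t,
  series (fun k => (v k)%:C * cis t ^+ k) @ \oo -->
  cexp ((lambda_ p n)%:C * w t) * (1 + \sum_(2 <= s < r.+1) b s * w t ^+ s).

(** The difference m - v is the sum over s > r of b s times the s-th difference of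
   the Poisson distribution. To bound its l1 norm it is not necessary to sum this
   series: truncated at S, it has for Fourier transform a remainder which is
   uniformly small, and so are the entries of the truncation error. There are only
   K of them in a partial sum of length K, and S is chosen after K. *)
Lemma norm1_difference L K :
  (forall S, \sum_(r.+1 <= s < S)
     normc (b s) * (Num.sqrt s%:R / Num.sqrt (lambda_ p n)) ^+ s <= L) ->
  \sum_(k < K) `|m k - v k| <= L.
Proof.
move=> bL; apply/ler_addgt0Pr => e e0.
have e1 : 0 < e / K.+1%:R by rewrite divr_gt0.
have [N NP] := expansion_tail b_expansion (ler0n _ 2) e1.
pose S := maxn N r.+1; have rS : (r.+1 <= S)%N by rewrite leq_maxr.
pose c k := \sum_(r.+1 <= s < S) b s * (D s k)%:C.
pose c1 k := \sum_(r.+1 <= s < S) normc (b s) * `|D s k|.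
have cc1 k : normc (c k) <= c1 k.
  apply: (le_trans (le_normc_sum _ _ _)); apply: ler_sum => s _.
  by rewrite normcM normc_real.
have sum_c1 M : \sum_(k < M) c1 k <= L.
  rewrite exchange_big/=; apply: le_trans (bL S).
  rewrite big_nat [leRHS]big_nat; apply: ler_sum => s /andP[rs _].
  rewrite -mulr_sumr ler_wpM2l ?normc_ge0// norm1_iter_diff_poisson_lambda//.
  exact: leq_trans rs.
have error k : normc ((m k)%:C - (v k)%:C - c k) <= e / K.+1%:R.
  pose g t := cexp ((lambda_ p n)%:C * w t)
    * (residue_function p n (w t) - \sum_(s < S) b s * w t ^+ s).
  apply: (@coef_le_fourier _ (fun k => (m k)%:C - (v k)%:C - c k) g).
  - have [Bm mP] := m_summable; have [Bv vP] := v_summable.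
    exists (Bm + Bv + L) => M.
    apply: (@le_trans _ _ (\sum_(i < M) (`|m i| + `|v i| + c1 i))).
      apply: ler_sum => i _; apply: (le_trans (le_normcB _ _)).
      by rewrite lerD// -!normc_real le_normcB.
    rewrite !big_split/=; apply: lerD; last exact: sum_c1.
    by apply: lerD; [exact: mP|exact: vP].
  - move=> t; rewrite (_ : series _ = fun M =>
        series (fun k => (m k)%:C * cis t ^+ k) M
      - series (fun k => (v k)%:C * cis t ^+ k) M
      - series (fun k => c k * cis t ^+ k) M); last first.
      apply/funext => M; rewrite /series/= -!sumrB; apply: eq_bigr => i _.
      by rewrite !mulrBl.
    have -> : g t = cexp ((lambda_ p n)%:C * w t) * residue_function p n (w t)
      - cexp ((lambda_ p n)%:C * w t) * (1 + \sum_(2 <= s < r.+1) b s * w t ^+ s)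
      - cexp ((lambda_ p n)%:C * w t) * (\sum_(r.+1 <= s < S) b s * w t ^+ s).
      have b01 : \sum_(0 <= s < 2) b s * w t ^+ s = 1.
        by rewrite big_ltn// big_nat1 residue_coef0 residue_coef1 mul0r addr0 mulr1.
      have split_sum : \sum_(s < S) b s * w t ^+ s = 1 +
          \sum_(2 <= s < r.+1) b s * w t ^+ s + \sum_(r.+1 <= s < S) b s * w t ^+ s.
        rewrite -(big_mkord xpredT (fun s => b s * w t ^+ s)) -b01.
        by rewrite (@big_cat_nat _ _ _ r.+1 0 S)// (@big_cat_nat _ _ _ 2 0 r.+1).
      by rewrite /g split_sum; ring.
    apply: cvgB; first by apply: cvgB; [exact: m_fourier|exact: v_fourier].
    exact: cvg_correction.
  - move=> t; rewrite normcM -[leRHS]mul1r ler_pM ?normc_ge0 ?fourier_bound//.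
    apply: NP; first exact: leq_maxl.
    by apply: (le_trans (le_normcB _ _)); rewrite normc_cis normc1.
apply: (@le_trans _ _ (\sum_(k < K) (c1 k + e / K.+1%:R))).
  apply: ler_sum => k _; rewrite -normc_real (rmorphB (real_complex R)).
  have -> : (m k)%:C - (v k)%:C = c k + ((m k)%:C - (v k)%:C - c k) by ring.
  by rewrite (le_trans (le_normcD _ _))// lerD.
rewrite big_split/=; apply: lerD; first exact: sum_c1.
rewrite sumr_const card_ord -[leLHS]mulr_natr.
by rewrite mulrAC ler_pdivrMr// ler_wpM2l ?(ltW e0)// ler_nat.
Qed.

Lemma norm1_difference_geometric (q : R) K :
  q = Num.sqrt (expR 1) * sigma_ p n / Num.sqrt (lambda_ p n) -> q < 1 ->
  \sum_(k < K) `|m k - v k| <= q ^+ r.+1 / (1 - q).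
Proof.
move=> qE q1; have q0 : 0 <= q.
  by rewrite qE divr_ge0 ?mulr_ge0 ?sqrtr_ge0.
apply: norm1_difference => S.
apply: (@le_trans _ _ (\sum_(r.+1 <= s < S) q ^+ s)).
  rewrite big_nat [leRHS]big_nat; apply: ler_sum => s /andP[rs _].
  have s0 : (0 < s)%N by rewrite (leq_trans _ rs).
  have l0 : 0 < Num.sqrt (lambda_ p n) by rewrite sqrtr_gt0 lambda_gt0.
  have c0 : 0 < Num.sqrt s%:R :> R by rewrite sqrtr_gt0 ltr0n.
  have -> : q = Num.sqrt (expR 1) * sigma_ p n / Num.sqrt s%:R
              * (Num.sqrt s%:R / Num.sqrt (lambda_ p n)).
    by rewrite qE; field; rewrite !gt_eqF.
  rewrite [leRHS]exprMn ler_wpM2r ?exprn_ge0 ?divr_ge0 ?sqrtr_ge0//.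
  exact: normc_residue_coef.
have [rS|Sr] := leqP r.+1 S; last first.
  by rewrite big_geq 1?ltnW// divr_ge0 ?exprn_ge0// subr_ge0 ltW.
rewrite -{1}[r.+1]add0n big_addn big_mkord.
under eq_bigr do rewrite addnC exprD.
by rewrite -mulr_sumr ler_wpM2l ?exprn_ge0// sum_geometric_le// q0 q1.
Qed.

End poisson_approximation.

Theorem theorem2 (R : realType) :
  exists C : R, C <= 570 /\
  forall (p : nat -> R) (hp : forall i, 0 < p i < 1)
    (n : nat) (hn : (1 <= n)%N)
    (d : measure_display) (T : measurableType d) (P : probability T R)
    (Y : 'I_n -> {RV P >-> nat})
    (hY1 : forall i : 'I_n, P (Y i @^-1` [set 1%N]) = (p i)%:E)
    (hY0 : forall i : 'I_n, P (Y i @^-1` [set 0%N]) = (1 - p i)%:E)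
    (hYind : independent_RVs Y)
    (X : {RV P >-> nat})
    (hX : forall t : T, X t = (\sum_(i < n) Y i t)%N)
    (hlambda : 16 * expR 1 * sigma_ p n ^+ 2 < lambda_ p n)
    (r : nat) (hr : (1 <= r)%N)
    (nu : {charge set nat -> \bar R})
    (hnu : approximation_scheme p n r nu),
  (dTV (distribution P X) nu <= (C * eta_ p n ^+ r.+1)%:E)%E /\
  eta_ p n < 1.
Proof.
exists 1; split=> [|p p01 n n0 d T P Y Y1 Y0 Yind X XE hlambda r r0 nu [b [bf nuF]]].
  by rewrite ler1n.
have l0 := lambda_gt0 p01 n0; have sg0 := sigma_gt0 p01 n0.
have sl0 : 0 < Num.sqrt (lambda_ p n) by rewrite sqrtr_gt0.
have e0 : 0 < Num.sqrt (expR 1) :> R by rewrite sqrtr_gt0 expR_gt0.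
set eta := eta_ p n.
have eta0 : 0 < eta by rewrite divr_gt0// !mulr_gt0.
have eta1 : eta < 1.
  rewrite ltr_pdivrMr// mul1r -(@ltr_pXn2r _ 2)// ?nnegrE ?mulr_ge0 ?ltW//.
  rewrite !exprMn (sqr_sqrtr (expR_ge0 1)) (sqr_sqrtr (ltW l0)).
  by rewrite (_ : 4 ^+ 2 = 16 :> R)//; ring.
split=> //.
(* with q < 1/4, half of the sum of the q ^+ s over s > r is at most q ^+ r.+1 *)
pose q := Num.sqrt (expR 1) * sigma_ p n / Num.sqrt (lambda_ p n).
have qE : q = eta / 4 by rewrite /q /eta /eta_; field; rewrite gt_eqF.
have q0 : 0 < q by rewrite qE divr_gt0.
have q1 : q < 1 by rewrite qE; lra.
pose m := bernoulli_sum_pmf p n; pose v k := fine (nu [set k]).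
have norm1 K : \sum_(k < K) `|m k - v k| <= q ^+ r.+1 / (1 - q).
  apply: (norm1_difference_geometric p01 n0 bf r0 _ _ _ _ _ erefl q1).
  - exact: bernoulli_sum_pmf_summable.
  - exact: charge_summable.
  - exact: cvg_bernoulli_sum_pmf.
  - move=> t; have := nuF t.
    by under eq_fun do rewrite -/(cis _) cisMn.
have half : 2^-1 * (q ^+ r.+1 / (1 - q)) <= 1 * eta ^+ r.+1.
  rewrite mul1r mulrCA; apply: (@le_trans _ _ (q ^+ r.+1)).
    rewrite ler_piMr ?exprn_ge0 ?(ltW q0)// -invfM invf_le1; rewrite qE; lra.
  by rewrite lerXn2r ?nnegrE ?(ltW q0) ?(ltW eta0)// qE; lra.
rewrite /dTV.
apply: (@le_trans _ _ (2^-1%:E * (q ^+ r.+1 / (1 - q))%:E)%E); last first.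
  by rewrite -EFinM lee_fin.
rewrite lee_pmul2l//; apply: lime_le; first exact: is_cvg_nneseries.
apply: nearW => K; rewrite big_mkord.
have -> : (\sum_(k < K) `|distribution P X [set nat_of_ord k] - nu [set nat_of_ord k]|)%E
    = (\sum_(k < K) `|m k - v k|)%:E; last by rewrite lee_fin.
rewrite -sumEFin; apply: eq_bigr => k _.
rewrite /distribution /pushforward (bernoulli_sum_law k Y1 Y0 Yind XE).
by rewrite -[nu _]fineK ?fin_num_measure// -EFinB abseEFin.
Qed.
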